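(* Let $(X,P,\mu)$ be a branching Markov chain with constant offspring distribution, i.e. $\mu(x)=\mu$ for all $x\in X$, with mean offspring $m=\sum_{k\ge1}k\mu_k$. For $x\in X$ let $F(x)$ denote the probability that the Markov chain $(X,P)$ started in $x$ ever returns to $x$ (at some time $n\ge1$). If $$m>\sup_{x\in X}\frac{1}{F(x)},$$ then $(X,P,\mu)$ is strongly recurrent.
   Context: $X$ is a countably infinite set and $P=(p(x,y))_{x,y\in X}$ is an irreducible stochastic matrix on $X$. For each $x\in X$, $\mu(x)=(\mu_k(x))_{k\ge 1}$ is a probability distribution on $\{1,2,3,\dots\}$ with finite mean $m(x)=\sum_{k\ge1} k\mu_k(x)$ (so every particle has at least one offspring). The branching Markov chain (BMC) $(X,P,\mu)$ is the following discrete-time particle system. At time $0$ there is one particle at a starting position. At each time step, each particle, located at $y$ say, is replaced by $k$ offspring particles with probability $\mu_k(y)$, and each offspring then independently moves to $z$ with probability $p(y,z)$; all branchings and movements are independent of the other particles and of the past. Let $\eta(n)$ be the total number of particles at time $n$, $x_i(n)$ the position of the $i$-th particle at time $n$ ($1\le i\le \eta(n)$), and $\mathbb{P}_x$ the law of the process started with one particle at $x$. Define $$\alpha(x):=\mathbb{P}_x\Big(\sum_{n=1}^\infty\sum_{i=1}^{\eta(n)}\mathbf 1\{x_i(n)=x\}=\infty\Big).$$ The BMC is strongly recurrent if $\alpha(x)=1$ for all $x\in X$. *)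

(* Defs.v *)
From HB Require Import structures.
From mathcomp Require Import all_boot all_order all_algebra.
From mathcomp Require Import all_classical all_reals all_analysis.

Set Implicit Arguments.
Unset Strict Implicit.
Unset Printing Implicit Defensive.

Import Order.TTheory GRing.Theory Num.Theory.
Import numFieldNormedType.Exports.

Local Open Scope classical_set_scope.
Local Open Scope ring_scope.
Local Open Scope ereal_scope.

Section TransitionMatrices.
Context {R : realType} {S : countType}.
Implicit Type p : S -> S -> R.

Definition stochastic p : Prop :=
  (forall x y, (0 <= p x y)%R) /\
  (forall x, \esum_(y in [set: S]) (p x y)%:E = 1).

Fixpoint mpow p (n : nat) (x y : S) : \bar R :=
  if n is k.+1 then \esum_(z in [set: S]) ((p x z)%:E * mpow p k z y)
  else (x == y)%:R%:E.

Definition irreducible p : Prop := forall x y, exists n, 0 < mpow p n x y.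

(* [Z] is, under [Pr], a time-homogeneous Markov chain started at [s0].
   The last clause is the Markov property
     P(Z_(n+1) = s_(n+1) | Z_0 = s_0, ..., Z_n = s_n) = K(s_n, s_(n+1))
   multiplied by the probability of the condition. *)
Definition markov_chain (d : measure_display) (T : measurableType d)
    (K : S -> S -> R) (s0 : S) (Pr : probability T R) (Z : nat -> T -> S) :
    Prop :=
  [/\ forall n s, measurable [set w | Z n w = s],
      Pr [set w | Z 0%N w = s0] = 1 &
      forall n (s : nat -> S),
        Pr [set w | forall i, (i <= n.+1)%N -> Z i w = s i] =
        Pr [set w | forall i, (i <= n)%N -> Z i w = s i] *
          (K (s n) (s n.+1))%:E].

(* [law x] is the law of the chain started at [x]. *)
Definition return_prob (d : measure_display) (T : measurableType d)
    (law : S -> probability T R) (Y : nat -> T -> S) (x : S) : \bar R :=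
  law x [set w | exists n, (0 < n)%N /\ Y n w = x].

End TransitionMatrices.

Section BranchingMarkovChain.
Context {R : realType} {X : countType}.
Implicit Types (p : X -> X -> R) (mu : X -> nat -> R).

Definition offspring_mean (nu : nat -> R) : \bar R :=
  \sum_(1 <= k <oo) (k%:R * nu k)%:E.

(* Probability distribution on {1, 2, 3, ...} with finite mean. *)
Definition offspring_distribution (nu : nat -> R) : Prop :=
  [/\ forall k, (0 <= nu k)%R,
      nu 0%N = 0%R,
      \sum_(1 <= k <oo) (nu k)%:E = 1 &
      offspring_mean nu < +oo].

(* Probability that a particle located at [y] is replaced by [size l]
   offspring whose successive positions are the entries of [l]. *)
Definition offspring_kernel p mu (y : X) (l : seq X) : R :=
  (mu y (size l) * \prod_(z <- l) p y z)%R.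

(* A configuration is the sequence x_1(n), ..., x_eta(n)(n) of the positions
   of all particles alive at time n.  The particles of [s] reproduce
   independently and the next configuration is the concatenation of their
   lists of offspring, so its law is the convolution of the
   [offspring_kernel]s: the offspring of the first particle are the first [i]
   entries of [t], and the other particles produce the remaining ones. *)
Fixpoint bmc_kernel p mu (s t : seq X) : R :=
  if s is y :: s' then
    (\sum_(0 <= i < (size t).+1)
       offspring_kernel p mu y (take i t) * bmc_kernel p mu s' (drop i t))%R
  else (t == [::])%:R%R.

(* The data (X, P, mu), together with a realization of the process: [Z n] is
   the configuration at time n, and [law x] is the law of the process started
   with one particle at [x]. *)
Definition branching_markov_chain p mu (d : measure_display)
    (T : measurableType d) (law : X -> probability T R)
    (Z : nat -> T -> seq X) : Prop :=
  [/\ infinite_set [set: X],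
      stochastic p,
      irreducible p,
      forall x, offspring_distribution (mu x) &
      forall x, markov_chain (bmc_kernel p mu) [:: x] (law x) Z].

Definition alpha (d : measure_display) (T : measurableType d)
    (law : X -> probability T R) (Z : nat -> T -> seq X) (x : X) : \bar R :=
  law x [set w | \sum_(1 <= n <oo) (count_mem x (Z n w))%:R%:E = +oo :> \bar R].

Definition strongly_recurrent (d : measure_display) (T : measurableType d)
    (law : X -> probability T R) (Z : nat -> T -> seq X) : Prop :=
  forall x, alpha law Z x = 1.

End BranchingMarkovChain.

(* Main.v *)
Require Import Defs.
From mathcomp Require Import finmap.
From HB Require Import structures.
From mathcomp Require Import all_boot all_order all_algebra.
From mathcomp Require Import all_classical all_reals all_analysis.
From mathcomp Require Import lra.

Set Implicit Arguments.
Unset Strict Implicit.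
Unset Printing Implicit Defensive.

Import Order.TTheory GRing.Theory Num.Theory.
Import numFieldNormedType.Exports.

Local Open Scope classical_set_scope.
Local Open Scope ring_scope.
Local Open Scope ereal_scope.

(** Write [f] for the generating function of the offspring law, so that
    [1 - f (1 - a)] has slope [m] at [a = 0].  For a function [g] on [X] with
    values in [[0, 1]], put [(T g)(y) = f ((P g)(y))].  If the particles of a
    configuration [s] are scored by [g] and the scores are multiplied, the
    expected score one step later is the product over [s] of [T g]
    ([bmc_kernel_prod]).  Consequently the probability that a single particle
    started at [y] has no descendant at [x] during [[N, N + L]] equals
    [(T^N w_L)(y)], where [w_L(y)] is the probability that [x] stays unvisited
    up to time [L] ([bmc_stay]).  Strong recurrence therefore reduces to
    [T^N w_L --> 0] as [L] grows ([avoid_vanishes]): then almost surely a visit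
    to [x] occurs after every time [N].

    The hypothesis on [m] provides [c] with [c < F(x)] for all [x] and
    [c * m > 1].  As the slope at [0] of [a |-> 1 - f (1 - c * a)] exceeds [1],
    there is a threshold [a0] with [f (1 - c * a) < 1 - a] for all [a] in
    [(0, a0]] ([pgf_below_line]).  This is used twice.

    Supersolution.  Fix [x], and let [u(y)] be the probability that the plain
    Markov chain avoids [x] up to a time so large that it returns to [x] by
    then with probability at least [c].  The function
    [psi = 1 - a0 * (1 - u)] satisfies [T psi <= psi]: at [x] this is the
    choice of [a0]; elsewhere it follows from [f(s) <= s] and the Markov
    property.  Behind it lies the Galton-Watson process in which a particle at
    [x] produces its offspring, each child is followed along one single line of
    descent, and those lines that come back to [x] are counted.  Since
    every particle has a child, the branching process hits [x] at least as
    easily as the chain does, so [w_L <= psi] for large [L], hence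
    [w_(L + j) <= T^j psi].

    Extinction of the limit.  The sequence [T^j psi] decreases to some [q] with
    [q <= T q] and [q(x) < 1]; the claim is [q = 0] ([subinvariant_eq0]).  Put
    [v = 1 - q].  From [f(s) <= s] one gets [v >= P v], so [v(y)] is at least
    the probability of hitting [z] from [y] times [v(z)].  By irreducibility
    [v > 0] everywhere, and [(P v)(y) >= c * v(y)], so that
    [1 - v(y) = q(y) <= f (1 - c * v(y))].  This is impossible if
    [v(y) <= a0], so [q <= b := 1 - a0] everywhere.  Finally [f(s) <= r * s] on
    [[0, b]] with [r = f(b) / b < 1], and iterating [q <= T q] gives
    [q <= b * r^n] for all [n]. *)

(** * Sums and averages over countable sets *)

Lemma esumZl (R : realType) (S : choiceType) (I : set S) (c : R)
    (a : S -> \bar R) :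
  (0 <= c)%R -> (forall s, 0 <= a s) ->
  \esum_(s in I) (c%:E * a s) = c%:E * \esum_(s in I) a s.
Proof.
move=> c0 a0.
have le (b : R) (e : S -> \bar R) : (0 <= b)%R -> (forall s, 0 <= e s) ->
    \esum_(s in I) (b%:E * e s) <= b%:E * \esum_(s in I) e s.
  move=> b0 e0; apply: ge_ereal_sup => _ [A [finA AI] <-].
  rewrite -ge0_mule_fsumr//; apply: lee_wpmul2l; first by rewrite lee_fin.
  by apply: ereal_sup_ubound; exists A.
apply/eqP; rewrite eq_le le//=.
have [->|cN0] := eqVneq c 0%R.
  by rewrite mul0e esum_ge0// => s _; rewrite mul0e.
have {}c0 : (0 < c)%R by rewrite lt_def cN0.
rewrite -lee_pdivlMl//.
apply: le_trans (le _ _ _ _); last 2 first.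
- by rewrite invr_ge0 ltW.
- by move=> s; rewrite mule_ge0// lee_fin ltW.
by apply: le_esum => s _; rewrite muleA -EFinM mulVf// mul1e.
Qed.

Section Mean.
Context {R : realType} {S : choiceType}.
Implicit Types (pi g h : S -> R).
Local Open Scope ring_scope.

Definition pmf pi : Prop :=
  (forall s, 0 <= pi s) /\ (\esum_(s in [set: S]) (pi s)%:E = 1)%E.

Definition unit_valued g : Prop := forall s, 0 <= g s <= 1.

Definition mean pi g : R := fine (\esum_(s in [set: S]) (pi s * g s)%:E)%E.

Lemma unit_ge0 g s : unit_valued g -> 0 <= g s.
Proof. by move=> /(_ s)/andP[]. Qed.

Lemma unit_le1 g s : unit_valued g -> g s <= 1.
Proof. by move=> /(_ s)/andP[]. Qed.

Lemma unit_compl g : unit_valued g -> unit_valued (fun s => 1 - g s).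
Proof. by move=> gu s; have /andP[] := gu s; lra. Qed.

Variable pi : S -> R.
Hypothesis pipmf : pmf pi.

Let pi0 s : 0 <= pi s. Proof. by case: pipmf => + _; apply. Qed.

Lemma mean_EFin g : unit_valued g ->
  ((mean pi g)%:E = \esum_(s in [set: S]) (pi s * g s)%:E)%E.
Proof.
move=> gu; rewrite /mean fineK// ge0_fin_numE.
  apply: (@le_lt_trans _ _ 1%E); last exact: ltry.
  case: pipmf => _ <-; apply: le_esum => s _; rewrite lee_fin.
  by rewrite ler_piMr ?unit_le1.
by apply: esum_ge0 => s _; rewrite lee_fin mulr_ge0// unit_ge0.
Qed.

Lemma mean_ge0 g : unit_valued g -> 0 <= mean pi g.
Proof.
move=> gu; rewrite -lee_fin mean_EFin//; apply: esum_ge0 => s _.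
by rewrite lee_fin mulr_ge0// unit_ge0.
Qed.

Lemma le_mean g h : unit_valued g -> unit_valued h -> (forall s, g s <= h s) ->
  mean pi g <= mean pi h.
Proof.
move=> gu hu gh; rewrite -lee_fin !mean_EFin//; apply: le_esum => s _.
by rewrite lee_fin ler_wpM2l.
Qed.

Lemma meanZ (c : R) g : 0 <= c <= 1 -> unit_valued g ->
  mean pi (fun s => c * g s) = c * mean pi g.
Proof.
move=> /andP[c0 c1] gu; apply: EFin_inj; rewrite EFinM !mean_EFin//; last first.
  by move=> s; have /andP[g0 g1] := gu s; rewrite mulr_ge0//= mulr_ile1.
rewrite -esumZl//; last by move=> s; rewrite lee_fin mulr_ge0// unit_ge0.
by apply: eq_esum => s _; rewrite -EFinM mulrCA.
Qed.

Lemma mean_compl g : unit_valued g ->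
  mean pi (fun s => 1 - g s) = 1 - mean pi g.
Proof.
move=> gu; apply/eqP; rewrite eq_sym subr_eq; apply/eqP/EFin_inj.
rewrite EFinD !mean_EFin//; last exact: unit_compl.
have g0 s := unit_ge0 s gu; have g1 s := unit_le1 s gu.
rewrite -esumD; last 2 first.
- by move=> s _; rewrite lee_fin mulr_ge0// subr_ge0.
- by move=> s _; rewrite lee_fin mulr_ge0.
case: pipmf => _ <-; apply: eq_esum => s _.
by rewrite -EFinD -mulrDr subrK mulr1.
Qed.

Lemma unit_affine (c : R) g : 0 <= c <= 1 -> unit_valued g ->
  unit_valued (fun s => 1 - c * (1 - g s)).
Proof.
move=> c01 gu; apply: unit_compl => s.
have /andP[? ?] := unit_compl gu s; have /andP[? ?] := c01.
by rewrite mulr_ge0//= mulr_ile1.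
Qed.

Lemma mean_affine (c : R) g : 0 <= c <= 1 -> unit_valued g ->
  mean pi (fun s => 1 - c * (1 - g s)) = 1 - c * (1 - mean pi g).
Proof.
move=> c01 gu; rewrite mean_compl; last first.
  move=> s; have /andP[? ?] := unit_compl gu s; have /andP[? ?] := c01.
  by rewrite mulr_ge0//= mulr_ile1.
by rewrite meanZ ?mean_compl//; exact: unit_compl.
Qed.

Lemma mean_cst (c : R) : 0 <= c <= 1 -> mean pi (fun=> c) = c.
Proof.
move=> c01; apply: EFin_inj; rewrite mean_EFin//.
rewrite (eq_esum (b := fun s => c%:E * (pi s)%:E)%E) => [|s _].
  by rewrite esumZl//; [case: pipmf => _ ->; rewrite mule1|case/andP: c01].
by rewrite -EFinM mulrC.
Qed.

Lemma mean_le1 g : unit_valued g -> mean pi g <= 1.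
Proof.
move=> gu; rewrite -[leRHS](@mean_cst 1) ?ler01 ?lexx//; apply: le_mean => //.
- by move=> s; rewrite ler01 lexx.
- by move=> s; exact: unit_le1.
Qed.

Lemma mean_unit g : unit_valued g -> 0 <= mean pi g <= 1.
Proof. by move=> gu; rewrite mean_ge0// mean_le1. Qed.

Lemma fsum_le_mean g (A : set S) : finite_set A -> unit_valued g ->
  \sum_(s \in A) pi s * g s <= mean pi g.
Proof.
move=> finA gu; rewrite -lee_fin mean_EFin// -fsumEFin//; apply: esum_ge.
by exists A.
Qed.

(** This is Fatou's inequality for [1 - g_ j], which is obtained from the sums
    over finite sets. *)
Lemma mean_limit (g_ : nat -> S -> R) g (a : R) :
  (forall j, unit_valued (g_ j)) -> unit_valued g ->
  (forall s, g_ j s @[j --> \oo] --> g s) ->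
  (forall j, a <= mean pi (g_ j)) -> a <= mean pi g.
Proof.
move=> g_u gu g_cvg a_le.
suff : mean pi (fun s => 1 - g s) <= 1 - a by rewrite mean_compl//; lra.
rewrite -lee_fin mean_EFin; last exact: unit_compl.
apply: ge_ereal_sup => _ [A [finA _] <-]; rewrite fsumEFin// lee_fin.
have cv : \sum_(s <- fset_set A) pi s * (1 - g_ j s) @[j --> \oo] -->
    \sum_(s <- fset_set A) pi s * (1 - g s).
  apply: cvg_big => [|s _]; first exact: add_continuous.
  apply: cvgMr; apply: cvgB; [exact: cvg_cst|exact: g_cvg].
rewrite fsbig_finite//; apply: (cvgr_to_le cv); apply: nearW => j.
rewrite -fsbig_finite//.
apply: le_trans (fsum_le_mean finA (unit_compl (g_u j))) _.
by rewrite mean_compl//; have := a_le j; lra.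
Qed.

End Mean.

(** * The offspring generating function *)

Section GeneratingFunction.
Context {R : realType}.
Variable nu : nat -> R.
Hypothesis nupmf : pmf nu.
Local Open Scope ring_scope.

Definition pgf (s : R) : R := mean nu (fun k => s ^+ k).

Lemma unit_expr (s : R) : 0 <= s <= 1 -> unit_valued (fun k => s ^+ k).
Proof. by move=> /andP[s0 s1] k; rewrite exprn_ge0//= exprn_ile1. Qed.

Lemma pgf_unit s : 0 <= s <= 1 -> 0 <= pgf s <= 1.
Proof. by move=> s01; apply: mean_unit => //; exact: unit_expr. Qed.

Lemma le_pgf s t : 0 <= s -> s <= t -> t <= 1 -> pgf s <= pgf t.
Proof.
move=> s0 st t1; apply: le_mean => //.
- by apply: unit_expr; rewrite s0 (le_trans st).
- by apply: unit_expr; rewrite t1 (le_trans s0).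
- by move=> k; rewrite lerXn2r// nnegrE// (le_trans s0).
Qed.

Hypothesis nu0 : nu 0%N = 0.

(** [pgf s / s] is nondecreasing because no particle dies childless; written
    without division. *)
Lemma pgf_ratio s t : 0 <= s -> s <= t -> t <= 1 -> t * pgf s <= s * pgf t.
Proof.
move=> s0 st t1; have t0 := le_trans s0 st; have s1 := le_trans st t1.
have t01 : 0 <= t <= 1 by rewrite t0. have s01 : 0 <= s <= 1 by rewrite s0.
have su := unit_expr s01; have tu := unit_expr t01.
have prod_unit (a : R) g : 0 <= a <= 1 -> unit_valued g ->
    unit_valued (fun k : nat => a * g k).
  move=> /andP[a0 a1] gu k; have /andP[? ?] := gu k.
  by rewrite mulr_ge0//= mulr_ile1.
rewrite -!meanZ//; rewrite -lee_fin !mean_EFin//; try exact: prod_unit.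
apply: le_esum => -[|k] _; first by rewrite nu0 !mul0r.
rewrite lee_fin ler_wpM2l//; first by case: nupmf.
rewrite !exprS mulrCA !ler_wpM2l//.
by rewrite lerXn2r// nnegrE.
Qed.

Lemma pgf1 : pgf 1 = 1.
Proof.
rewrite /pgf -[RHS](mean_cst nupmf (c := 1)) ?ler01 ?lexx//.
by congr (mean nu _); apply/funext => k; rewrite expr1n.
Qed.

Lemma pgf_le s : 0 <= s <= 1 -> pgf s <= s.
Proof.
move=> /andP[s0 s1]; have := pgf_ratio s0 s1 (lexx 1).
by rewrite pgf1 mul1r mulr1.
Qed.

(** Factor [1 - (1 - d) ^+ k] as [d] times a geometric sum of [k] terms, each
    at least [(1 - d) ^+ K]. *)
Lemma onem_expr_ge (d : R) (k K : nat) : 0 <= d <= 1 -> (k <= K)%N ->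
  k%:R * d * (1 - d) ^+ K <= 1 - (1 - d) ^+ k.
Proof.
move=> /andP[d0 d1]; elim: k => [|k IH] kK; first by rewrite !mul0r expr0 subrr.
have e0 : 0 <= 1 - d by lra.
have e1 : 1 - d <= 1 by lra.
have := IH (ltnW kK).
have : (1 - d) ^+ K <= (1 - d) ^+ k by rewrite ler_wiXn2l// ltnW.
rewrite exprS -natr1; set u := _ ^+ K; set v := _ ^+ k; nra.
Qed.

Lemma bernoulli_onem (d : R) (K : nat) : 0 <= d <= 1 ->
  1 - K%:R * d <= (1 - d) ^+ K.
Proof.
move=> /andP[d0 d1]; elim: K => [|K IH]; first by rewrite mul0r expr0 subr0.
have K0 : 0 <= K%:R :> R by [].
by rewrite exprS -natr1; set u := _ ^+ K in IH *; nra.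
Qed.

(** The partial sum of the mean bounds from below the slope of
    [1 - pgf (1 - d)] at [d = 0], up to the factor [(1 - d) ^+ K] which is close
    to [1]. *)
Lemma pgf_below_line (c : R) (K : nat) : 0 <= c <= 1 ->
  1 < c * \sum_(0 <= k < K) k%:R * nu k ->
  exists2 a0 : R, 0 < a0 < 1 &
    forall a, 0 < a <= a0 -> pgf (1 - c * a) < 1 - a.
Proof.
move=> /andP[c0 c1]; set m := \sum_(0 <= k < K) _ => cm1.
have m0 : 0 <= m.
  by apply: sumr_ge0 => k _; rewrite mulr_ge0//; case: nupmf.
have cm0 : 0 < c * m by lra.
have e0 : 0 < c * m * K.+1%:R by rewrite mulr_gt0// ltr0n.
(* Up to this value of [a], [c * m * (1 - K * a)] exceeds [1]. *)
exists ((c * m - 1) / (c * m * K.+1%:R)).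
  rewrite divr_gt0 ?subr_gt0//= ltr_pdivrMr// mul1r -natr1 mulrDr mulr1.
  have : 0 <= c * m * K%:R by rewrite mulr_ge0// ltW.
  lra.
move=> a /andP[a0]; rewrite ler_pdivlMr// => aK.
have a1 : a < 1.
  rewrite -(ltr_pM2r cm0); apply: le_lt_trans (_ : c * m - 1 < _); last by lra.
  apply: le_trans aK; apply: ler_wpM2l (ltW a0) _ _ _.
  by rewrite ler_peMr// ?ler1n// ltW.
set d := c * a; have d01 : 0 <= d <= 1.
  by rewrite /d mulr_ge0 ?mulr_ile1// ltW.
have du : 0 <= 1 - d <= 1 by move: d01; lra.
have low : d * (1 - d) ^+ K * m <= 1 - pgf (1 - d).
  rewrite -mean_compl//; last exact: unit_expr.
  apply: le_trans
    (fsum_le_mean nupmf (finite_II K) (unit_compl (unit_expr du))).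
  rewrite -fsbig_ord /m big_mkord mulr_sumr; apply: ler_sum => k _.
  have := onem_expr_ge d01 (ltnW (ltn_ord k)).
  have : 0 <= nu k by case: nupmf.
  set u := _ ^+ K; set v := _ ^+ k; set r := k%:R; nra.
have bern := bernoulli_onem K d01.
have K0 : 0 <= K%:R :> R by [].
have da : d <= a by rewrite /d ler_piMl// ltW.
have dm0 : 0 <= d * m by apply: mulr_ge0 => //; case/andP: d01.
suff : a < d * m * (1 - K%:R * d).
  move=> lt_a; have : d * m * (1 - K%:R * d) <= d * m * (1 - d) ^+ K.
    by rewrite ler_wpM2l.
  move: low; rewrite -/d; set u := _ ^+ K; nra.
have step : d * m * (1 - K%:R * a) <= d * m * (1 - K%:R * d).
  by rewrite ler_wpM2l// lerB// ler_wpM2l.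
apply: lt_le_trans step; rewrite /d [c * a]mulrC -!mulrA ltr_pMr// mulrA.
move: aK; rewrite -natr1 mulrDr; set e := c * m in cm0 *; nra.
Qed.

End GeneratingFunction.

(** * Staying in a sequence of sets *)

Lemma measure_countable_bigcup (R : realType) (S : countType)
    (d : measure_display) (T : measurableType d) (P : {measure set T -> \bar R})
    (E : S -> set T) :
  (forall s, measurable (E s)) -> trivIset [set: S] E ->
  P (\bigcup_s E s) = \esum_(s in [set: S]) P (E s).
Proof.
move=> mE tE; pose F n := if pickle_inv n is Some s then E s else set0.
have FE s : F (pickle s) = E s by rewrite /F pickleK_inv.
have -> : \bigcup_s E s = \bigcup_n F n.
  apply/seteqP; split=> [w [s _ Esw]|w [n _]].
    by exists (pickle s); rewrite ?FE.
  by rewrite /F; case: (pickle_inv _) => [s Esw|//]; exists s.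
rewrite measure_bigcup; last 2 first.
- by move=> n _; rewrite /F; case: (pickle_inv n).
- move=> i j _ _; rewrite /F.
  case: (pickle_inv i) (@pickle_invK S i) => [s|_].
    2: by rewrite set0I => -[].
  case: (pickle_inv j) (@pickle_invK S j) => [t|_].
    2: by rewrite setI0 => _ -[].
  by move=> /= tj si /tE st; rewrite -tj -si st.
rewrite nneseries_esum// (_ : [set x | _] = setT); last first.
  by apply/seteqP; split => // n _ /=; rewrite inE.
have -> : \esum_(s in [set: S]) P (E s) =
    \esum_(n in pickle @` [set: S]) P (F n).
  rewrite esum_image; first by apply: eq_esum => s _; rewrite FE.
  by move=> s t _ _; exact: (pcan_inj pickleK).
rewrite [RHS]esum_mkcond; apply: eq_esum => n _; case: ifPn => // /negP nS.
rewrite /F; case: (pickle_inv n) (@pickle_invK S n) => [s /= sn|_].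
  by exfalso; apply: nS; rewrite inE; exists s.
by rewrite measure0.
Qed.

Section MarkovChains.
Context {R : realType} {S : countType}.
Implicit Types (K : S -> S -> R) (B : nat -> pred S).

(** First-step analysis of the probability that the chain with transition kernel
    [K] started at [s] is in [B i] at every time [i <= n]. *)
Fixpoint stay K B n s : \bar R :=
  (B 0%N s)%:R%:E *
  (if n is k.+1
   then \esum_(t in [set: S]) ((K s t)%:E * stay K (fun i => B i.+1) k t)
   else 1).

Lemma stay_ge0 K B n s : (forall s t, (0 <= K s t)%R) -> 0 <= stay K B n s.
Proof.
move=> K0; elim: n B s => [|n IH] B s /=; first by rewrite mule1 lee_fin ler0n.
rewrite mule_ge0 ?lee_fin ?ler0n//; apply: esum_ge0 => t _.
by rewrite mule_ge0 ?lee_fin.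
Qed.

Context {d : measure_display} {T : measurableType d}.
Variables (K : S -> S -> R) (s0 : S) (Pr : probability T R) (Z : nat -> T -> S).
Hypotheses (K0 : forall s t, (0 <= K s t)%R) (mc : markov_chain K s0 Pr Z).

Lemma measurable_state n (A : set S) : measurable [set w | A (Z n w)].
Proof.
case: mc => mZ _ _.
have -> : [set w | A (Z n w)] = \bigcup_(s in A) [set w | Z n w = s].
  by apply/seteqP; split=> [w Aw|w [s As /= ->]//]; exists (Z n w).
rewrite bigcup_mkcond; apply: countable_bigcupT_measurable => [|s].
  exact: countableP.
by case: ifP.
Qed.

Lemma measurable_states (A : nat -> set S) (D : set nat) :
  measurable [set w | forall i, D i -> A i (Z i w)].
Proof.
have -> : [set w | forall i, D i -> A i (Z i w)] =
    \bigcap_(i in D) [set w | A i (Z i w)] by [].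
by apply: bigcap_measurableType => i _; exact: measurable_state.
Qed.

Let cylinder n (s : nat -> S) := [set w | forall i, (i <= n)%N -> Z i w = s i].

(** The Markov property of the definition extends a trajectory at its end, while
    [stay] peels off the beginning.  Prescribing the trajectory up to a
    variable time [n] reconciles the two. *)
Lemma prob_cylinder_stay m B n (s : nat -> S) :
  Pr [set w | cylinder n s w /\ forall j, (j <= m)%N -> B j (Z (n + j) w)] =
  Pr (cylinder n s) * stay K B m (s n).
Proof.
have [Bs|Bs] := boolP (B 0%N (s n)); last first.
  rewrite (_ : [set w | _] = set0) ?measure0.
    by case: m => [|m] /=; rewrite (negbTE Bs) mul0e mule0.
  apply/seteqP; split=> // w [cw Bw].
  by have := Bw 0%N isT; rewrite addn0 cw// (negbTE Bs).
elim: m B n s Bs => [|m IH] B n s Bs /=; rewrite Bs.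
  rewrite !mule1; congr (Pr _); apply/seteqP; split=> [w []//|w cw].
  by split=> // j; rewrite leqn0 => /eqP ->; rewrite addn0 cw.
rewrite mul1e; pose st t i := if i == n.+1 then t else s i.
have stn t : st t n.+1 = t by rewrite /st eqxx.
have sti t i : (i <= n)%N -> st t i = s i.
  by rewrite /st => i_n; rewrite ltn_eqF.
have IH' t : Pr [set w | cylinder n.+1 (st t) w /\
      forall j, (j <= m)%N -> B j.+1 (Z (n.+1 + j) w)] =
    Pr (cylinder n s) * ((K (s n) t)%:E * stay K (fun i => B i.+1) m t).
  have -> : Pr (cylinder n s) * ((K (s n) t)%:E * stay K (fun i => B i.+1) m t)
      = Pr (cylinder n.+1 (st t)) * stay K (fun i => B i.+1) m t.
    case: mc => _ _ ->; rewrite stn sti// muleA; congr (Pr _ * _ * _).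
    by apply/seteqP; split => w cw i i_n; rewrite ?sti// ?cw// sti.
  have [Bt|Bt] := boolP (B 1%N t).
    by rewrite (IH (fun i => B i.+1)) ?stn.
  rewrite (_ : [set w | _] = set0) ?measure0.
    by case: {+}m => [|k] /=; rewrite (negbTE Bt) mul0e !mule0.
  apply/seteqP; split=> // w [cw Bw].
  by have := Bw 0%N isT; rewrite addn0 cw// stn (negbTE Bt).
transitivity (\esum_(t in [set: S])
    (Pr (cylinder n s) * ((K (s n) t)%:E * stay K (fun i => B i.+1) m t))).
  under eq_esum do rewrite -IH'.
  rewrite -measure_countable_bigcup.
  - congr (Pr _); apply/seteqP; split=> [w [cw Bw]|w [t _ [cw Bw]]].
      exists (Z n.+1 w) => //; split=> [i|j jm].
        2: by rewrite addSnnS; exact: Bw.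
      rewrite leq_eqVlt => /predU1P[->|]; first by rewrite stn.
      by rewrite ltnS => i_n; rewrite sti// cw.
    split=> [i i_n|[_|j jm]]; first by rewrite cw ?sti// ltnW.
      by rewrite addn0 cw// sti.
    by rewrite -addSnnS; exact: Bw.
  - move=> t; apply: measurableI.
      exact: (measurable_states (fun i => [set st t i])
        [set i | (i <= n.+1)%N]).
    apply: (@bigcap_measurableType _ _
      (fun j => [set w | B j.+1 (Z (n.+1 + j) w)]) [set j | (j <= m)%N]) => j _.
    exact: (measurable_state _ [set x | B j.+1 x]).
  - move=> t u _ _ [w [[ct _] [cu _]]].
    by rewrite -(stn t) -(stn u) -ct// -cu.
have /fineK <- : Pr (cylinder n s) \is a fin_num.
  apply: fin_num_measure.
  exact: (measurable_states (fun i => [set s i]) [set i | (i <= n)%N]).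
by rewrite esumZl// => [|t]; rewrite ?fine_ge0// mule_ge0 ?lee_fin ?stay_ge0.
Qed.

Lemma prob_stay m B :
  Pr [set w | forall j, (j <= m)%N -> B j (Z j w)] = stay K B m s0.
Proof.
case: (mc) => mZ Z0 _.
have E : [set w | Z 0%N w = s0] = cylinder 0%N (fun=> s0).
  apply/seteqP; split=> [w Zw i|w]; first by rewrite leqn0 => /eqP ->.
  by apply.
have := prob_cylinder_stay m B 0%N (fun=> s0).
rewrite -E [X in X * _]Z0 mul1e => <-.
have mA : measurable [set w | forall j, (j <= m)%N -> B j (Z j w)].
  exact: (measurable_states (fun i => [set x | B i x]) [set i | (i <= m)%N]).
have mE : measurable [set w | Z 0%N w = s0] by exact: mZ.
rewrite [LHS](measureDI _ mA mE) [X in X + _](_ : _ = 0); last first.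
  apply/eqP; rewrite eq_le measure_ge0 andbT.
  apply: (@le_trans _ _ (Pr (~` [set w | Z 0%N w = s0]))).
    apply: le_measure; rewrite ?inE; [exact: measurableD|exact: measurableC|].
    by move=> w [].
  by rewrite probability_setC// [X in 1 - X]Z0 subee.
by rewrite add0e; congr (Pr _); apply/seteqP; split=> w [].
Qed.

Lemma measurable_hitting (s : S) :
  measurable [set w | exists n, (0 < n)%N /\ Z n w = s].
Proof.
have -> : [set w | exists n, (0 < n)%N /\ Z n w = s] =
    \bigcup_(n in [set n | (0 < n)%N]) [set w | Z n w = s].
  by apply/seteqP; split=> w [n]; [case=> ? ?|move=> ? ?]; exists n.
by apply: bigcup_measurable => n _; case: mc.
Qed.

End MarkovChains.

(** * The branching kernel on products *)

Section BranchingKernel.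
Context {R : realType} {X : countType}.
Implicit Types (p : X -> X -> R) (mu : X -> nat -> R) (g : X -> R).

Lemma esum_prod_size (a : X -> R) (m : R) (k : nat) :
  (forall z, (0 <= a z)%R) -> \esum_(z in [set: X]) (a z)%:E = m%:E ->
  \esum_(t in [set t : seq X | size t = k]) (\prod_(z <- t) a z)%:E =
  (m ^+ k)%:E.
Proof.
move=> a0 am; have prod0 (t : seq X) : (0 <= \prod_(z <- t) a z)%R.
  by apply: prodr_ge0.
have m0 : (0 <= m)%R by rewrite -lee_fin -am esum_ge0// => z _; rewrite lee_fin.
elim: k => [|k IH].
  rewrite (_ : [set t | _] = [set [::]]); last first.
    by apply/seteqP; split=> [t /size0nil|t ->].
  by rewrite esum_set1 ?big_nil ?lee01.
rewrite (reindex_esum ([set: X] `*`` fun=> [set t : seq X | size t = k]) _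
  (fun zt => zt.1 :: zt.2)); last first.
  split=> [[z t] [_ /= ->]//|[z t] [y u] _ _ [-> ->]//|[//|z t] [tk]].
  by exists (z, t).
rewrite -(esum_esum (a := fun z t => (\prod_(y <- z :: t) a y)%:E)); last first.
  by move=> z t _ _; rewrite lee_fin.
rewrite (eq_esum (b := fun z => (m ^+ k)%:E * (a z)%:E)); last first.
  move=> z _; rewrite muleC -IH -esumZl//.
  by apply: eq_esum => t _; rewrite big_cons EFinM.
rewrite esumZl ?exprn_ge0//.
by rewrite am -EFinM exprSr.
Qed.

(** A pair [(t, i)] of a sequence and a cutting point is the same as a pair of
    sequences, so a sum of convolutions is a product of sums. *)
Lemma esum_split_seq (A B : seq X -> R) (a b : R) :
  (forall t, (0 <= A t)%R) -> (forall t, (0 <= B t)%R) ->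
  \esum_(t in [set: seq X]) (A t)%:E = a%:E ->
  \esum_(t in [set: seq X]) (B t)%:E = b%:E ->
  \esum_(t in [set: seq X])
     (\sum_(0 <= i < (size t).+1) A (take i t) * B (drop i t))%R%:E =
  (a * b)%:E.
Proof.
move=> A0 B0 Aa Bb.
have a0 : (0 <= a)%R by rewrite -lee_fin -Aa esum_ge0// => z _; rewrite lee_fin.
have b0 : (0 <= b)%R by rewrite -lee_fin -Bb esum_ge0// => z _; rewrite lee_fin.
transitivity (\esum_(t in [set: seq X]) \esum_(i in `I_(size t).+1)
    (A (take i t) * B (drop i t))%:E).
  apply: eq_esum => t _; rewrite esum_fset//; last first.
    by move=> i _; rewrite lee_fin mulr_ge0.
  by rewrite -fsbig_ord big_mkord -sumEFin.
rewrite esum_esum; last by move=> t i _ _; rewrite lee_fin mulr_ge0.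
rewrite (reindex_esum ([set: seq X] `*`` fun=> [set: seq X]) _
  (fun uw => (uw.1 ++ uw.2, size uw.1))); last first.
  split.
  - by move=> [u w] _; split => //=; rewrite size_cat ltnS leq_addr.
  - move=> [u w] [u' w'] _ _ /= [e es].
    move: (congr1 (take (size u)) e) (congr1 (drop (size u)) e).
    rewrite take_size_cat// drop_size_cat// es.
    by rewrite take_size_cat// drop_size_cat// => -> ->.
  - move=> [t i] [_ /= it]; exists (take i t, drop i t) => //=.
    by rewrite cat_take_drop size_takel.
rewrite /=; under eq_esum do rewrite take_size_cat// drop_size_cat//.
rewrite -(esum_esum (a := fun u w => (A u * B w)%:E)); last first.
  by move=> u w _ _; rewrite lee_fin mulr_ge0.
rewrite (eq_esum (b := fun u => b%:E * (A u)%:E)); last first.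
  by move=> u _; rewrite muleC -Bb -esumZl.
by rewrite esumZl// Aa -EFinM mulrC.
Qed.

(** Expected product of the scores [g] of the children of a particle at [y]. *)
Definition reproduce p mu g y : R := pgf (mu y) (mean (p y) g).

Section Kernel.
Variables (p : X -> X -> R) (mu : X -> nat -> R).
Hypotheses (ppmf : forall x, pmf (p x)) (mupmf : forall x, pmf (mu x)).

Lemma reproduce_unit g : unit_valued g -> unit_valued (reproduce p mu g).
Proof. by move=> gu y; apply: pgf_unit => //; exact: mean_unit. Qed.

Let p0 x y : (0 <= p x y)%R. Proof. by case: (ppmf x) => + _; apply. Qed.
Let mu0 x k : (0 <= mu x k)%R. Proof. by case: (mupmf x) => + _; apply. Qed.

Lemma offspring_kernel_ge0 y t : (0 <= offspring_kernel p mu y t)%R.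
Proof. by rewrite mulr_ge0// prodr_ge0. Qed.

Lemma bmc_kernel_ge0 s t : (0 <= bmc_kernel p mu s t)%R.
Proof.
elim: s t => [|y s IH] t /=; first exact: ler0n.
by apply: sumr_ge0 => i _; rewrite mulr_ge0// offspring_kernel_ge0.
Qed.

Variable g : X -> R.
Hypothesis gu : unit_valued g.

Let prodg0 (t : seq X) : (0 <= \prod_(z <- t) g z)%R.
Proof. by apply: prodr_ge0 => z _; exact: unit_ge0. Qed.

Lemma offspring_kernel_prod y :
  \esum_(t in [set: seq X])
     (offspring_kernel p mu y t * \prod_(z <- t) g z)%:E =
  (reproduce p mu g y)%:E.
Proof.
rewrite (_ : [set: seq X] = \bigcup_k [set t : seq X | size t = k]); last first.
  by apply/seteqP; split=> // t _; exists (size t).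
rewrite esum_bigcupT; last 2 first.
- by move=> i j _ _ [t [/= <- <-]].
- by move=> t; rewrite lee_fin mulr_ge0// offspring_kernel_ge0.
rewrite mean_EFin//; last exact/unit_expr/mean_unit.
apply: eq_esum => k _; rewrite EFinM.
rewrite -(esum_prod_size (a := fun z => p y z * g z)%R); last 2 first.
- by move=> z; rewrite mulr_ge0// unit_ge0.
- by rewrite mean_EFin.
rewrite -esumZl//; last first.
  by move=> t; rewrite lee_fin prodr_ge0// => z _; rewrite mulr_ge0// unit_ge0.
by apply: eq_esum => t /= <-; rewrite -EFinM big_split mulrA.
Qed.

(** The branching property: the particles of a configuration have independent
    offspring. *)
Lemma bmc_kernel_prod s :
  \esum_(t in [set: seq X]) (bmc_kernel p mu s t * \prod_(z <- t) g z)%:E =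
  (\prod_(y <- s) reproduce p mu g y)%:E.
Proof.
elim: s => [|y s IH].
  rewrite big_nil (eq_esum (b := fun t => if t \in [set [::]] then 1 else 0)).
    by rewrite -esum_mkcond esum_set1.
  move=> t _ /=; case: eqP => [->|tN]; first by rewrite mem_set// mul1r big_nil.
  by rewrite memNset// mul0r.
rewrite big_cons -(esum_split_seq _ _ (offspring_kernel_prod y) IH);
  last 2 first.
- by move=> t; rewrite mulr_ge0// offspring_kernel_ge0.
- by move=> t; rewrite mulr_ge0// bmc_kernel_ge0.
apply: eq_esum => t _ /=; rewrite mulr_suml; congr (_ %:E).
apply: eq_bigr => i _.
rewrite -[in X in (_ * \prod_(z <- X) _)%R](cat_take_drop i t).
by rewrite big_cat mulrACA.
Qed.

End Kernel.
End BranchingKernel.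

(** * The probability of avoiding a point *)

Section Avoidance.
Context {R : realType} {X : countType}.
Variables (p : X -> X -> R) (nu : nat -> R).
Hypotheses (ppmf : forall x, pmf (p x)) (nupmf : pmf nu) (nu0 : nu 0%N = 0%R).
Local Open Scope ring_scope.

Let T := reproduce p (fun=> nu).

(** With [A] the averaging operator of the chain, the probability that the chain
    started at [y] is never at [x] up to time [n]; with [A := T], the same for
    all particles of the branching process. *)
Fixpoint avoid (A : (X -> R) -> X -> R) (x : X) n y : R :=
  (y != x)%:R * (if n is k.+1 then A (avoid A x k) y else 1).

Let W := avoid T.
Let U := avoid (fun g y => mean (p y) g).

Lemma le_reproduce g h : unit_valued g -> unit_valued h ->
  (forall y, g y <= h y) -> forall y, T g y <= T h y.
Proof.
move=> gu hu gh y; have /andP[g0 g1] := mean_unit (ppmf y) gu.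
have /andP[h0 h1] := mean_unit (ppmf y) hu.
by apply: le_pgf => //; exact: le_mean.
Qed.

Lemma reproduce_le_mean g y : unit_valued g -> T g y <= mean (p y) g.
Proof. by move=> gu; apply: pgf_le => //; exact: mean_unit. Qed.

Lemma avoid_unit A x n : (forall g, unit_valued g -> unit_valued (A g)) ->
  unit_valued (avoid A x n).
Proof.
move=> Au; elim: n => [|n IH] y /=; case: (y != x);
  rewrite ?(mul0r, mul1r, mulr1, ler01, lexx)//.
exact: Au.
Qed.

Lemma avoid_self A x n : avoid A x n x = 0.
Proof. by case: n => [|n] /=; rewrite eqxx mul0r. Qed.

Lemma bmc_avoid_unit x n : unit_valued (W x n).
Proof. by apply: avoid_unit => g; exact: reproduce_unit. Qed.

Lemma chain_avoid_unit x n : unit_valued (U x n).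
Proof. by apply: avoid_unit => g gu y; exact: mean_unit. Qed.
Hint Resolve bmc_avoid_unit chain_avoid_unit : core.

Lemma chain_avoid_anti x n y : U x n.+1 y <= U x n y.
Proof.
elim: n y => [|n IH] y; apply: ler_wpM2l => //.
  by apply: mean_le1 => //; exact: (chain_avoid_unit x 0).
by apply: le_mean => //; exact: (chain_avoid_unit x n.+1).
Qed.

(** Following one child per particle embeds the chain into the branching
    process. *)
Lemma bmc_avoid_le_chain x n y : W x n y <= U x n y.
Proof.
elim: n y => [//|n IH] y; rewrite /W /U /= -/W -/U ler_wpM2l//.
apply: le_trans (reproduce_le_mean _ (bmc_avoid_unit x n)) _.
exact: le_mean.
Qed.

Lemma bmc_avoid_le_reproduce x n y : W x n.+1 y <= T (W x n) y.
Proof.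
rewrite /W /= -/W ler_piMl//; last by case: (y != x).
by have /andP[] := reproduce_unit ppmf (fun=> nupmf) (bmc_avoid_unit x n) y.
Qed.

(** Stop the submartingale [q] at the first visit to [x]. *)
Lemma subharmonic_le (x : X) q :
  unit_valued q -> (forall y, q y <= mean (p y) q) ->
  forall n y, q y <= 1 - (1 - q x) * (1 - U x n y).
Proof.
move=> qu sub; have qx : 0 <= 1 - q x <= 1 by have /andP[] := qu x; lra.
elim=> [|n IH] y; rewrite /U /= -/U; have [->|_] /= := eqVneq y x.
- by rewrite mul0r; lra.
- by rewrite mulr1 subrr mulr0 subr0 unit_le1.
- by rewrite mul0r; lra.
- rewrite mul1r -mean_affine//; apply: le_trans (sub y) _; apply: le_mean => //.
  exact: unit_affine.
Qed.

(** The value at [y] is at most an average in which [x] has positive weight. *)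
Lemma subharmonic_lt1 x q : irreducible p -> unit_valued q ->
  (forall y, q y <= mean (p y) q) -> q x < 1 -> forall y, q y < 1.
Proof.
move=> irr qu sub qx y; have [n] := irr y x => pn.
have v0 z : 0 <= 1 - q z by rewrite subr_ge0 unit_le1.
have p0 y' z : 0 <= p y' z by case: (ppmf y') => + _; apply.
have mpow0 k y' z : (0 <= mpow p k y' z)%E.
  elim: k y' => [|k IH] y' /=; first by rewrite lee_fin ler0n.
  by apply: esum_ge0 => t _; rewrite mule_ge0 ?lee_fin.
have le_v k z : ((1 - q x)%:E * mpow p k z x <= (1 - q z)%:E)%E.
  elim: k z => [|k IH] z /=.
    by case: eqVneq => [->|_]; rewrite ?mule1 ?mule0 ?lee_fin.
  rewrite -esumZl//; last by move=> t; rewrite mule_ge0 ?lee_fin.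
  apply: (@le_trans _ _ (1 - mean (p z) q)%:E); last by rewrite lee_fin lerB.
  rewrite -mean_compl// mean_EFin//; last exact: unit_compl.
  apply: le_esum => t _; rewrite muleCA EFinM.
  by apply: lee_wpmul2l; rewrite ?lee_fin.
rewrite -subr_gt0 -lte_fin; apply: lt_le_trans (le_v n y).
by rewrite mule_gt0// lte_fin subr_gt0.
Qed.

Variables (c a0 : R).
Hypotheses (c01 : 0 <= c <= 1) (a01 : 0 < a0 < 1).
Hypothesis below : forall a, 0 < a <= a0 -> pgf nu (1 - c * a) < 1 - a.
Hypothesis returns : forall x, exists n, mean (p x) (U x n) <= 1 - c.
Hypothesis irr : irreducible p.

(** Read [q y] as the probability that a particle at [y] fails to have some
    property that holds as soon as it holds for one child.  A particle at [y]
    reproduces once and each child succeeds if it comes back to [y] and then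
    succeeds; so if the success probability [a := 1 - q y] is positive, it is at
    least [1 - pgf nu (1 - c * a)], which exceeds [a] as long as [a <= a0].
    Hence [q] is bounded by [1 - a0] everywhere, and the multiplicity of the
    offspring then drives it to [0]. *)
Lemma subinvariant_eq0 x q : unit_valued q -> (forall y, q y <= T q y) ->
  q x < 1 -> forall y, q y = 0.
Proof.
move=> qu subq qx.
have /andP[c0 c1] := c01; have /andP[a00 a0lt1] := a01.
have sub y : q y <= mean (p y) q.
  by apply: le_trans (subq y) (reproduce_le_mean _ qu).
have q1 := subharmonic_lt1 irr qu sub qx.
have qb y : q y <= 1 - a0.
  have [n Un] := returns y; have := q1 y; have /andP[qy0 _] := qu y.
  set a := 1 - q y => qy1; have a_gt0 : 0 < a by rewrite /a; lra.
  have [aa0|] := leP a a0; last by rewrite /a; lra.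
  have a_c : 0 <= a <= 1 by rewrite /a; lra.
  have := below (_ : 0 < a <= a0); rewrite a_gt0 aa0 => /(_ isT).
  rewrite {2}/a subKr ltNge => /negP[]; apply: le_trans (subq y) _.
  apply: le_pgf => //; first exact: mean_ge0.
    2: by have := mulr_ge0 c0 (ltW a_gt0); lra.
  apply: le_trans (_ : _ <= 1 - a * (1 - mean (p y) (U y n))) _.
    rewrite -mean_affine//; apply: le_mean => //; first exact: unit_affine.
    by move=> z; exact: subharmonic_le.
  rewrite lerB// mulrC; apply: ler_wpM2l (ltW a_gt0) _ _ _.
  by rewrite lerBrDr addrC -lerBrDr.
(* On [[0, b]] the graph of [pgf nu] lies below the line of slope [r < 1]. *)
pose b := 1 - a0; have b01 : 0 < b < 1 by rewrite /b; lra.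
have fb : pgf nu b < b.
  apply: le_lt_trans (below (_ : 0 < a0 <= a0)); last by rewrite a00 lexx.
  have : c * a0 <= a0 by rewrite ler_piMl// ltW.
  have : 0 <= c * a0 by rewrite mulr_ge0// ltW.
  by rewrite /b => ? ?; apply: le_pgf => //; lra.
pose r := pgf nu b / b; have r01 : 0 <= r < 1.
  have /andP[b0 b1] := b01.
  rewrite ltr_pdivrMr// mul1r fb divr_ge0 ?(ltW b0)//.
  by have /andP[] : 0 <= pgf nu b <= 1 by apply: pgf_unit => //; lra.
have qr n y : q y <= b * r ^+ n.
  have /andP[b0 b1] := b01; have /andP[r0 r1] := r01.
  elim: n y => [|n IH] y; first by rewrite expr0 mulr1 qb.
  set s := b * r ^+ n in IH *.
  have s0 : 0 <= s by rewrite mulr_ge0 ?exprn_ge0// ltW.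
  have sb : s <= b by rewrite ler_piMr ?exprn_ile1// ltW.
  apply: (@le_trans _ _ (pgf nu s)).
    apply: le_trans (subq y) _; apply: le_pgf => //.
    - exact: mean_ge0.
    - rewrite -[leRHS](mean_cst (ppmf y) (c := s)).
        2: by rewrite s0 (le_trans sb)// ltW.
      by apply: le_mean => // z; rewrite s0 (le_trans sb)// ltW.
    - by rewrite (le_trans sb)// ltW.
  rewrite exprSr mulrA -/s /r mulrA ler_pdivlMr// mulrC.
  by apply: pgf_ratio => //; exact: ltW.
move=> y; apply/eqP; rewrite eq_le unit_ge0// andbT.
have lim0 : b * r ^+ n @[n --> \oo] --> b * 0.
  by apply: cvgMr; apply: cvg_expr; rewrite ger0_norm; case/andP: r01.
rewrite mulr0 in lim0; apply: (cvgr_to_ge lim0); exact: nearW.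
Qed.

(** Lets the inequality [a <= T _] pass to the limit of a decreasing sequence,
    through the average over [p y] and then through the one over [nu]. *)
Lemma reproduce_limit (g_ : nat -> X -> R) g y (a : R) :
  (forall j, unit_valued (g_ j)) -> (forall j z, g_ j.+1 z <= g_ j z) ->
  unit_valued g -> (forall z, g_ j z @[j --> \oo] --> g z) ->
  (forall j, a <= T (g_ j) y) -> a <= T g y.
Proof.
move=> g_u g_anti gu g_cvg a_le.
pose s_ j := mean (p y) (g_ j); pose s := inf (range s_).
have s_u j : 0 <= s_ j <= 1 by apply: mean_unit.
have lb : has_lbound (range s_).
  by exists 0 => _ [j _ <-]; have /andP[] := s_u j.
have s_le j : s <= s_ j by apply: ge_inf => //; exists j.
have s_cvg : s_ j @[j --> \oo] --> s.
  apply: nonincreasing_cvgn => //; apply/nonincreasing_seqP => j.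
  exact: le_mean.
have s0 : 0 <= s.
  by apply: (cvgr_to_ge s_cvg); apply: nearW => j; have /andP[] := s_u j.
have s1 : s <= 1 by apply: le_trans (s_le 0%N) _; have /andP[] := s_u 0%N.
apply: (@le_trans _ _ (pgf nu s)).
  apply: (@mean_limit _ _ _ nupmf (fun j k => s_ j ^+ k)) => //.
  - by move=> j; exact: unit_expr.
  - by apply: unit_expr; rewrite s0.
  - by move=> k; exact: (cvg_comp _ _ s_cvg (@exprn_continuous R k s)).
apply: le_pgf => //; last exact: mean_le1.
exact: (@mean_limit _ _ _ (ppmf y) g_).
Qed.

(** Squeeze the avoidance probabilities under the iterates [g_ j] of a
    supersolution [psi]; their limit [q] satisfies [q <= T q] and [q x < 1],
    hence vanishes. *)
Lemma avoid_vanishes x y N (e : R) : 0 < e -> exists L, iter N T (W x L) y <= e.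
Proof.
move=> e0; have [M UM] := returns x; have /andP[a00 a0lt1] := a01.
have /andP[c0 c1] := c01.
(* Probability of failure for a chain that succeeds with probability [a0] if
   it hits [x] within time [M], and fails otherwise. *)
pose psi z := 1 - a0 * (1 - U x M z).
have a01' : 0 <= a0 <= 1 by rewrite !ltW.
have psiu : unit_valued psi by exact: unit_affine.
have super z : T psi z <= psi z.
  have [->|zx] := eqVneq z x.
    rewrite /psi /U avoid_self subr0 mulr1 /T /reproduce.
    apply: le_trans (ltW (below (_ : 0 < a0 <= a0))); last by rewrite a00 lexx.
    apply: le_pgf => //; [exact: mean_ge0| |].
      rewrite mean_affine// lerB// mulrC; apply: ler_wpM2l (ltW a00) _ _ _.
      by rewrite lerBrDr addrC -lerBrDr.
    by rewrite lerBlDr lerDl mulr_ge0// ltW.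
  apply: le_trans (reproduce_le_mean _ psiu) _.
  rewrite /psi mean_affine// lerB//; apply: ler_wpM2l (ltW a00) _ _ _.
  rewrite lerB//.
  by have := chain_avoid_anti x M z; rewrite /U /= zx mul1r.
pose g_ j := iter j T psi.
have g_u j : unit_valued (g_ j).
  by elim: j => //= j IH; exact: reproduce_unit.
have g_anti j z : g_ j.+1 z <= g_ j z.
  elim: j z => [|j IH] z; first exact: super.
  exact: (le_reproduce (g_u j.+1) (g_u j)).
pose q z := inf (range (g_ ^~ z)).
have lb z : has_lbound (range (g_ ^~ z)).
  by exists 0 => _ [j _ <-]; exact: unit_ge0.
have q_cvg z : g_ j z @[j --> \oo] --> q z.
  by apply: nonincreasing_cvgn => //; apply/nonincreasing_seqP => j.
have q_le j z : q z <= g_ j z by apply: ge_inf => //; exists j.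
have qu : unit_valued q.
  move=> z; rewrite (le_trans (q_le 0%N z)) ?unit_le1// andbT.
  by apply: (cvgr_to_ge (q_cvg z)); apply: nearW => j; exact: unit_ge0.
have qx : q x < 1.
  apply: le_lt_trans (q_le 0%N x) _.
  by rewrite /g_ /= /psi /U avoid_self subr0 mulr1; lra.
have q0 : q y = 0.
  apply: (subinvariant_eq0 qu _ qx) => z.
  by apply: (@reproduce_limit g_) => // j; exact: q_le j.+1 z.
have Wpsi z : W x M z <= psi z.
  apply: le_trans (bmc_avoid_le_chain _ _ _) _; rewrite /psi.
  have := chain_avoid_unit x M z; set u := U x M z => /andP[u0 u1]; nra.
have Wg j z : W x (j + M) z <= g_ j z.
  elim: j z => [|j IH] z; first exact: Wpsi.
  apply: le_trans (bmc_avoid_le_reproduce _ _ _) _.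
  exact: (le_reproduce (bmc_avoid_unit _ _) (g_u j)).
have iterWu n j : unit_valued (iter n T (W x j)).
  by elim: n => //= n IH; exact: reproduce_unit.
have iterWg n j z : iter n T (W x (j + M)) z <= g_ (n + j)%N z.
  elim: n z => [|n IH] z; first exact: Wg.
  exact: (le_reproduce (iterWu _ _) (g_u (n + j)%N)).
have : \forall j \near \oo, g_ j y < e.
  by apply: (cvgr_lt _ (q_cvg y)); rewrite q0.
move=> [j0 _ /(_ (N + j0)%N)]; rewrite /= leq_addl => /(_ isT) ge.
by exists (j0 + M)%N; apply: le_trans (iterWg _ _ _) (ltW ge).
Qed.

End Avoidance.

(** * Visits of the two processes *)

Section Recurrence.
Context {R : realType} {X : countType}.
Variables (p : X -> X -> R) (nu : nat -> R).
Hypotheses (ppmf : forall x, pmf (p x)) (nupmf : pmf nu).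

Let T := reproduce p (fun=> nu).
Let W := avoid T.
Let U := avoid (fun g y => mean (p y) g).

Let iter_unit x N n : unit_valued (iter N T (W x n)).
Proof.
elim: N => [|N IH]; last exact: reproduce_unit.
exact: bmc_avoid_unit.
Qed.

Lemma prod_avoid x n (s : seq X) : (\prod_(y <- s) W x n y =
  (x \notin s)%:R * \prod_(y <- s) (if n is k.+1 then T (W x k) y else 1))%R.
Proof.
elim: s => [|y s IH]; first by rewrite !big_nil mulr1.
rewrite !big_cons IH inE negb_or eq_sym.
have -> : W x n y = ((y != x)%:R * (if n is k.+1 then T (W x k) y else 1))%R.
  by case: n {IH}.
by case: (y == x); rewrite /= ?mul0r// !mul1r mulrCA.
Qed.

(** No particle at [x] during [[N, N + M]]: after the first [N] steps, which are
    unconstrained, every particle has to keep its descendants away from [x]. *)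
Lemma bmc_stay x N M s :
  stay (bmc_kernel p (fun=> nu)) (fun i t => (i < N)%N || (x \notin t))
    (N + M) s = (\prod_(y <- s) iter N T (W x M) y)%:E.
Proof.
elim: N s => [|N IH] s; last first.
  rewrite /= mul1e -(bmc_kernel_prod ppmf (fun=> nupmf)) ?iter_unit//.
  by apply: eq_esum => t _; rewrite EFinM -IH.
rewrite add0n; elim: M s => [|M IH] s.
  by rewrite (prod_avoid x 0) big1_eq mulr1 /= mule1.
rewrite (prod_avoid x M.+1) EFinM /=; congr (_ * _).
rewrite -(bmc_kernel_prod ppmf (fun=> nupmf)); last exact: (iter_unit x 0 M).
by apply: eq_esum => t _; rewrite EFinM -IH.
Qed.

Lemma chain_stay x n y :
  stay p (fun _ z => z != x) n y = (U x n y)%:E.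
Proof.
elim: n y => [|n IH] y; first by rewrite /= mule1 /U /= mulr1.
rewrite [U _ _ _]/= EFinM /=; congr (_ * _).
rewrite (mean_EFin (ppmf y) (chain_avoid_unit ppmf x n)).
by apply: eq_esum => z _; rewrite EFinM IH.
Qed.

(** A return happens within a finite time, so a strict lower bound on its
    probability already holds for a finite horizon. *)
Lemma return_prob_gt (d : measure_display) (S : measurableType d)
    (law : X -> probability S R) (Y : nat -> S -> X) (x : X) (c : R) :
  markov_chain p x (law x) Y -> c%:E < return_prob law Y x ->
  exists n, (mean (p x) (U x n) <= 1 - c)%R.
Proof.
move=> mc; apply: contraPP => noU; apply/negP; rewrite -leNgt.
have p0 y z : (0 <= p y z)%R by case: (ppmf y) => + _; apply.
pose B (i : nat) : pred X := fun y => (i == 0)%N || (y != x).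
pose E n := [set w | forall j, (j <= n.+1)%N -> B j (Y j w)].
have PE n : law x (E n) = (mean (p x) (U x n))%:E.
  rewrite (prob_stay p0 mc) /= mul1e.
  rewrite (mean_EFin (ppmf x) (chain_avoid_unit ppmf x n)).
  by apply: eq_esum => z _; rewrite EFinM -chain_stay.
have mE n : measurable (E n).
  exact: (measurable_states mc (fun i => [set y | B i y])
    [set i | (i <= n.+1)%N]).
have EI : \bigcap_n E n = ~` [set w | exists n, (0 < n)%N /\ Y n w = x].
  apply/seteqP; split=> [w Ew [n [n0 Yx]]|w Nw n _ [//|j] _].
    by have := Ew n I n (leqnSn _); rewrite /B Yx eqxx orbF -leqn0 leqNgt n0.
  by apply/eqP => Yx; apply: Nw; exists j.+1.
have lim : law x (E n) @[n --> \oo] --> law x (\bigcap_n E n).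
  apply: nonincreasing_cvg_mu => //.
  - by rewrite [X in X < _]PE ltry.
  - exact: bigcapT_measurable.
  - move=> m n mn; apply/subsetPset => w Ew j jm; apply: Ew.
    exact: leq_trans jm _.
have : (1 - c)%:E <= law x (\bigcap_n E n).
  rewrite -(cvg_lim _ lim)//; apply: lime_ge.
    by apply/cvg_ex; exists (law x (\bigcap_n E n)).
  apply: nearW => n; rewrite PE lee_fin ltW// ltNge; apply/negP => Un.
  by apply: noU; exists n.
have mret := measurable_hitting mc x.
rewrite EI probability_setC// /return_prob.
have : law x [set w | exists n, (0 < n)%N /\ Y n w = x] \is a fin_num.
  exact: fin_num_measure.
by move=> /fineK <-; rewrite -EFinB !lee_fin; lra.
Qed.

Lemma infinitely_often (d : measure_display) (S : measurableType d)
    (Z : nat -> S -> seq X) (x : X) :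
  [set w | \sum_(1 <= n <oo) (count_mem x (Z n w))%:R%:E = +oo :> \bar R] =
  ~` \bigcup_N [set w | forall n, (N <= n)%N -> x \notin Z n w].
Proof.
apply/seteqP; split=> w /=.
  move=> sum_oo [N _ /= noN].
  move: sum_oo; rewrite (nneseries_split 1 N) => [|k _].
    2: by rewrite lee_fin.
  rewrite [X in _ + X]eseries0 => [|k Nk _]; last first.
    rewrite (eqP (_ : count_mem x (Z k w) == 0%N))//.
    rewrite -leqn0 leqNgt -has_count has_pred1 noN//.
    by rewrite (leq_trans _ Nk)// leq_addl.
  by rewrite adde0 sumEFin.
move=> io; have {}io N : exists2 n, (N <= n)%N & x \in Z n w.
  apply: contrapT => noN; apply: io; exists N => // n /= Nn.
  by apply/negP => xZ; apply: noN; exists n.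
have part (k : nat) : exists2 n, (0 < n)%N &
    (k%:R%:E <= \sum_(1 <= i < n) (count_mem x (Z i w))%:R%:E :> \bar R).
  elim: k => [|k [n n0 kn]]; first by exists 1%N => //; rewrite big_geq.
  have [m nm xm] := io n; exists m.+1 => //.
  rewrite big_nat_recr ?(leq_trans n0)//= -natr1 EFinD; apply: leeD.
    apply: le_trans kn _; rewrite (big_cat_nat n0 nm)/= leeDl//.
    by apply: sume_ge0 => i _; rewrite lee_fin.
  by rewrite lee_fin ler1n -has_count has_pred1.
apply/eq_infty => r; have [n n0 rn] := part (Num.bound `|r|%R).
apply: le_trans (_ : (Num.bound `|r|%R)%:R%:E <= _).
  by rewrite lee_fin (le_trans (ler_norm r))// ltW// archi_boundP.
apply: le_trans rn _; apply: nneseries_lim_ge => i _ _.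
by rewrite lee_fin.
Qed.

Lemma no_late_visit_null (d : measure_display) (S : measurableType d)
    (P : probability S R) (Z : nat -> S -> seq X) (x y : X) (N : nat) :
  markov_chain (bmc_kernel p (fun=> nu)) [:: y] P Z ->
  (forall e : R, (0 < e)%R -> exists L, (iter N T (W x L) y <= e)%R) ->
  P [set w | forall n, (N <= n)%N -> x \notin Z n w] = 0.
Proof.
move=> mc vanish; have K0 := bmc_kernel_ge0 ppmf (fun=> nupmf).
apply/eqP; rewrite eq_le measure_ge0 andbT; apply/lee_addgt0Pr => e e0.
rewrite add0e; have [L le_e] := vanish e e0.
pose B i (t : seq X) := (i < N)%N || (x \notin t).
apply: (@le_trans _ _ (P [set w | forall j, (j <= N + L)%N -> B j (Z j w)])).
  apply: le_measure; rewrite ?inE.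
  - exact: (measurable_states mc (fun=> [set t : seq X | x \notin t])
      [set n | (N <= n)%N]).
  - exact: (measurable_states mc (fun i => [set t | B i t])
      [set j | (j <= N + L)%N]).
  - by move=> w noN j _; rewrite /B; case: ltnP => //= /noN.
by rewrite (prob_stay K0 mc) bmc_stay big_seq1 lee_fin.
Qed.

End Recurrence.

Lemma pmf_offspring (R : realType) (nu : nat -> R) :
  offspring_distribution nu -> pmf nu.
Proof.
move=> [nu_ge0 nu0 nu1 _]; split=> //.
have nuE k : 0 <= (nu k)%:E by rewrite lee_fin.
rewrite -nneseries_esumT// nneseries_recl//.
by rewrite nu0 add0e.
Qed.

Lemma offspring_mean_partial (R : realType) (nu : nat -> R) (r : R) :
  (forall k, (0 <= nu k)%R) -> r%:E < offspring_mean nu ->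
  exists K, (r < \sum_(0 <= k < K) k%:R * nu k)%R.
Proof.
move=> nu_ge0; apply: contraPP => noK; apply/negP; rewrite -leNgt.
apply: lime_le.
  by apply: is_cvg_nneseries => k _ _; rewrite lee_fin mulr_ge0.
apply: nearW => -[|n].
  rewrite big_geq// leNgt; apply/negP => r0.
  by apply: noK; exists 0%N; rewrite big_geq.
rewrite sumEFin lee_fin leNgt; apply/negP => rn; apply: noK; exists n.+1.
by rewrite big_ltn// mul0r add0r.
Qed.

Theorem proposition3p6 (R : realType) (X : countType) (p : X -> X -> R)
    (mu : X -> nat -> R) (nu : nat -> R)
    (d : measure_display) (T : measurableType d)
    (law : X -> probability T R) (Z : nat -> T -> seq X)
    (bmc : branching_markov_chain p mu law Z)
    (mu_const : forall x, mu x = nu)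
    (d' : measure_display) (T' : measurableType d')
    (law' : X -> probability T' R) (Y : nat -> T' -> X)
    (mc : forall x, markov_chain p x (law' x) Y)
    (hm : ereal_sup [set (return_prob law' Y x)^-1 | x in [set: X]]
          < offspring_mean nu) :
  strongly_recurrent law Z.
Proof.
case: bmc => _ [p0 p1] irr off bmc x.
have muE : mu = fun=> nu by apply/funext.
have ppmf y : pmf (p y) by split; [exact: p0|exact: p1].
have offnu : offspring_distribution nu by rewrite -(mu_const x).
have nupmf := pmf_offspring offnu; case: (offnu) => nu_ge0 nu0 _ mean_fin.
set s := ereal_sup _ in hm.
have F_ge0 y : 0 <= return_prob law' Y y by exact: measure_ge0.
have F_le1 y : return_prob law' Y y <= 1.
  by apply: probability_le1; exact: measurable_hitting (mc y) _.
have Fs y : (return_prob law' Y y)^-1 <= s by apply: ereal_sup_ubound; exists y.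
have s1 : 1 <= s by apply: le_trans (Fs x); rewrite inve_ge1.
have sfin : s \is a fin_num.
  by rewrite ge0_fin_numE ?(lt_trans hm)// (le_trans _ s1).
have [r sr] : exists r, s = r%:E by exists (fine s); rewrite fineK.
rewrite sr lee_fin in s1; rewrite sr in hm.
have [K rK] := offspring_mean_partial nu_ge0 hm.
set m := (\sum_(0 <= k < K) _)%R in rK.
(* Its inverse is the midpoint of [r] and [m], so [1 / m < c < 1 / r]. *)
pose c := (2 / (r + m))%R.
have c0 : (0 <= c <= 1)%R.
  by rewrite divr_ge0 ?ler_pdivrMr; lra.
have cm : (1 < c * m)%R.
  by rewrite /c mulrAC ltr_pdivlMr; lra.
have cr : (c < r^-1)%R.
  by rewrite -[ltRHS]mul1r ltr_pdivlMr 1?mulrAC ?ltr_pdivrMr; lra.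
have cF y : c%:E < return_prob law' Y y.
  apply: (@lt_le_trans _ _ (r^-1)%:E); first by rewrite lte_fin.
  have r0 : (0 < r)%R by lra.
  have -> : (r^-1)%:E = (r%:E)^-1 by rewrite inver gt_eqF.
  by rewrite inve_ple ?inE ?lee_fin ?(ltW r0)// -sr.
have [a0 a01 below] := pgf_below_line nupmf c0 cm.
have mN N : measurable [set w | forall n, (N <= n)%N -> x \notin Z n w].
  exact: (measurable_states (bmc x) (fun=> [set t : seq X | x \notin t])
    [set n | (N <= n)%N]).
have mU : measurable
    (\bigcup_N [set w | forall n, (N <= n)%N -> x \notin Z n w]).
  exact: bigcup_measurable.
rewrite /alpha infinitely_often probability_setC//.
rewrite (_ : law x _ = 0) ?sube0//; apply: measure_negligible => //.
apply: negligible_bigcup => N.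
apply/negligibleP => //; apply: (no_late_visit_null (y := x) ppmf nupmf).
  by rewrite -muE.
move=> e e0; apply: (avoid_vanishes ppmf nupmf nu0 c0 a01 below) => // y.
exact: (return_prob_gt ppmf (mc y) (cF y)).
Qed.
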